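(* For any real sequence $\lambda=(\lambda_{IJ})_{I,J\in\mathcal{D}}$, $$\|\lambda\|_X\le\|M_\lambda\|_{\ell^2_{\mathbb{Z}}(L^2(\mathbb{R}^2))\to\ell^2_{\mathbb{Z}}(L^2(\mathbb{R}^2))}.$$
   Context: Functions are real-valued, and $\mathcal{D}$ is the standard dyadic grid in $\mathbb{R}$, i.e. the collection of intervals $[k2^{-i},(k+1)2^{-i})$, $i,k\in\mathbb{Z}$. Letters $I,J$ always denote elements of $\mathcal{D}$, and $\langle f\rangle_I=\frac1{|I|}\int_I f$. The norm $\|\lambda\|_X\in[0,\infty]$ is $$\|\lambda\|_X=\sup\Big|\sum_{I,J}\lambda_{IJ}\langle g_J\rangle_I\langle u_I\rangle_J\Big|,$$ where the supremum is over families $(g_J)_{J\in\mathcal{D}}$, $(u_I)_{I\in\mathcal{D}}$ of functions in $L^2(\mathbb{R})$ with $g_J\neq0$ for only finitely many $J$, $u_I\ne0$ for only finitely many $I$, and $\sum_J\|g_J\|_2^2=\sum_I\|u_I\|_2^2=1$. For $x,y\in\mathbb{R}$ and $i,j\in\mathbb{Z}$ put $M_\lambda^{ij}(x,y)=2^{(i+j)/2}\lambda_{I_i(x)J_j(y)}$, where $I_i(x)$ and $J_j(y)$ are the unique dyadic intervals of lengths $2^{-i}$ and $2^{-j}$ containing $x$ and $y$ respectively. For a sequence $a=(a_i)_{i\in\mathbb{Z}}$ of functions $\mathbb{R}^2\to\mathbb{R}$ one (formally) defines the sequence of functions $M_\lambda a$ by $$(M_\lambda a)_j(x,y)=\sum_{i\in\mathbb{Z}}M_\lambda^{ij}(x,y)a_i(x,y),\qquad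 j\in\mathbb{Z}.$$ Here $\|a\|_{\ell^2_{\mathbb{Z}}(L^2(\mathbb{R}^2))}=(\sum_i\|a_i\|_{L^2(\mathbb{R}^2)}^2)^{1/2}$, and $\|M_\lambda\|_{\ell^2_{\mathbb{Z}}(L^2(\mathbb{R}^2))\to\ell^2_{\mathbb{Z}}(L^2(\mathbb{R}^2))}\in[0,\infty]$ is the least $C$ such that $\|M_\lambda a\|_{\ell^2_{\mathbb{Z}}(L^2(\mathbb{R}^2))}\le C\|a\|_{\ell^2_{\mathbb{Z}}(L^2(\mathbb{R}^2))}$ for all $a\in\ell^2_{\mathbb{Z}}(L^2(\mathbb{R}^2))$ with only finitely many nonzero $a_i$ (and $\infty$ if there is no such finite $C$). *)

(* Defs.v *)
From HB Require Import structures.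
From mathcomp Require Export all_boot all_order all_algebra.
From mathcomp Require Export all_classical all_reals all_analysis.

Set Implicit Arguments.
Unset Strict Implicit.
Unset Printing Implicit Defensive.

Import Order.TTheory GRing.Theory Num.Theory.

Local Open Scope classical_set_scope.
Local Open Scope ring_scope.

(* The pair (i, k) stands for the dyadic interval [k 2^-i, (k+1) 2^-i[; by
   [dyadic_itv_inj] below this is a bijective parametrization of the grid. *)
Definition dyadic : choiceType := (int * int)%type.

Definition dyadic_itv (R : realType) (I : dyadic) : set R :=
  `[I.2%:~R * 2 ^ (- I.1), (I.2 + 1)%:~R * 2 ^ (- I.1)[.

Definition dyadic_at (R : realType) (i : int) (x : R) : dyadic :=
  (i, Num.floor (x * 2 ^ i)).

Lemma dyadic_atP (R : realType) (i k : int) (x : R) :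
  dyadic_itv (i, k) x <-> dyadic_at i x = (i, k).
Proof.
have p0 : 0 < (2 : R) ^ i by exact: exprz_gt0.
rewrite /dyadic_itv /dyadic_at /= in_itv /= -invr_expz.
rewrite ler_pdivrMr // ltr_pdivlMr //; split.
  by move=> /andP[h1 h2]; congr pair; apply: floor_def; rewrite h1.
by move=> [<-]; exact: floor_itv.
Qed.

Lemma dyadic_itv_inj (R : realType) : injective (@dyadic_itv R).
Proof.
move=> [i k] [j l] /seteqP [h1 h2].
have e0 : forall n : int, 0 < (2 : R) ^ (- n) by move=> n; exact: exprz_gt0.
have itv_in : forall n m (t : R), 0 <= t < 1 ->
    dyadic_itv (n, m) ((m%:~R + t) * 2 ^ (- n)).
  move=> n m t /andP[t0 t1]; rewrite /dyadic_itv /= in_itv /=.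
  by rewrite ler_pM2r // ltr_pM2r // lerDl t0 rmorphD /= ltrD2l.
have bnd : forall n m n' m', dyadic_itv (n, m) `<=` @dyadic_itv R (n', m') ->
    m'%:~R * 2 ^ (- n') <= m%:~R * 2 ^ (- n) :> R /\
    (m + 1)%:~R * 2 ^ (- n) <= (m' + 1)%:~R * 2 ^ (- n') :> R.
  move=> n m n' m' h; split.
    have := h _ (itv_in n m 0 _); rewrite lexx ltr01 addr0 => /(_ isT).
    by rewrite /dyadic_itv /= in_itv /= => /andP[].
  rewrite leNgt; apply/negP => hlt.
  have low : m'%:~R * 2 ^ (- n') <= m%:~R * 2 ^ (- n) :> R.
    have := h _ (itv_in n m 0 _); rewrite lexx ltr01 addr0 => /(_ isT).
    by rewrite /dyadic_itv /= in_itv /= => /andP[].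
  have low' : m%:~R * 2 ^ (- n) < (m' + 1)%:~R * 2 ^ (- n') :> R.
    have := h _ (itv_in n m 0 _); rewrite lexx ltr01 addr0 => /(_ isT).
    by rewrite /dyadic_itv /= in_itv /= => /andP[].
  have := h ((m' + 1)%:~R * 2 ^ (- n')).
  rewrite /dyadic_itv /= !in_itv /= ltxx andbF => h'.
  by have := h' _; rewrite (ltW low') hlt => /(_ isT).
have [a1 a2] := bnd _ _ _ _ h1; have [b1 b2] := bnd _ _ _ _ h2.
have E1 : k%:~R * 2 ^ (- i) = l%:~R * 2 ^ (- j) :> R.
  by apply/eqP; rewrite eq_le b1 a1.
have E2 : (k + 1)%:~R * 2 ^ (- i) = (l + 1)%:~R * 2 ^ (- j) :> R.
  by apply/eqP; rewrite eq_le a2 b2.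
have E3 : (2 : R) ^ (- i) = 2 ^ (- j).
  by move: E2; rewrite !rmorphD /= !mulrDl E1 !mul1r => /addrI.
have ij : i = j.
  have /oppr_inj // : - i = - j.
  by apply: (@ieexprIz R 2) => //; rewrite gt_eqF // ltr1n.
move: E1; rewrite ij => /(mulIf (lt0r_neq0 (e0 j))) /intr_inj kl.
by rewrite kl.
Qed.

Definition mean (R : realType) (f : R -> R) (I : dyadic) : R :=
  (fine (@lebesgue_measure R (dyadic_itv I)))^-1 *
  \int[@lebesgue_measure R]_(x in dyadic_itv I) f x.

Definition plane_measure (R : realType) :
    {measure set (measurableTypeR R * measurableTypeR R) -> \bar R} :=
  (@lebesgue_measure R \x @lebesgue_measure R)%E.

(* Elements of L^2 are given by Borel representatives, i.e. elements of
   [Lfun mu 2]; a family has finite support when all but finitely many of its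
   representatives are the zero function. *)
Definition finL2_family d (T : measurableType d) (R : realType)
    (mu : {measure set T -> \bar R}) (S : choiceType) (f : S -> T -> R) : Prop :=
  (forall s, f s \in Lfun mu 2%:E) /\ finite_set [set s | f s <> cst 0].

Definition l2L2_sqnorm d (T : measurableType d) (R : realType)
    (mu : {measure set T -> \bar R}) (S : choiceType) (f : S -> T -> R) : \bar R :=
  (\esum_(s in [set: S]) 'N[mu]_2%:E [EFin \o f s] ^+ 2)%E.

Definition l2L2_norm d (T : measurableType d) (R : realType)
    (mu : {measure set T -> \bar R}) (S : choiceType) (f : S -> T -> R) : \bar R :=
  sqrte (l2L2_sqnorm mu f).

(* [\sum_(p \in A)] is a finitely supported sum: only finitely many pairs
   (I, J) contribute when g and u have finite support. *)
Definition X_form (R : realType) (lambda : dyadic -> dyadic -> R)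
    (g u : dyadic -> R -> R) : R :=
  \sum_(p \in [set: dyadic * dyadic])
    lambda p.1 p.2 * mean (g p.2) p.1 * mean (u p.1) p.2.

Definition X_norm (R : realType) (lambda : dyadic -> dyadic -> R) : \bar R :=
  ereal_sup [set r : \bar R | exists g u : dyadic -> R -> R,
    [/\ finL2_family (@lebesgue_measure R) g,
        finL2_family (@lebesgue_measure R) u,
        l2L2_sqnorm (@lebesgue_measure R) g = 1%E,
        l2L2_sqnorm (@lebesgue_measure R) u = 1%E &
        r = `|X_form lambda g u|%:E]].

Definition M_coef (R : realType) (lambda : dyadic -> dyadic -> R)
    (i j : int) (p : R * R) : R :=
  2 `^ ((i + j)%:~R / 2) * lambda (dyadic_at i p.1) (dyadic_at j p.2).

Definition M_apply (R : realType) (lambda : dyadic -> dyadic -> R)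
    (a : int -> R * R -> R) (j : int) (p : R * R) : R :=
  \sum_(i \in [set: int]) M_coef lambda i j p * a i p.

(* The infimum of the empty set is +oo. *)
Definition M_norm (R : realType) (lambda : dyadic -> dyadic -> R) : \bar R :=
  ereal_inf [set C%:E | C in [set C : R | 0 <= C /\
    forall a : int -> R * R -> R, finL2_family (plane_measure R) a ->
      (l2L2_norm (plane_measure R) (M_apply lambda a)
         <= C%:E * l2L2_norm (plane_measure R) a)%E]].

(* Main.v *)
Require Import Defs.
From mathcomp Require Import measurable_realfun ring lra.

Set Implicit Arguments.
Unset Strict Implicit.
Unset Printing Implicit Defensive.

Import Order.TTheory GRing.Theory Num.Theory.

Local Open Scope classical_set_scope.
Local Open Scope ring_scope.

(** The bilinear form that defines the X-norm is a pairing with [M_lambda] in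
    l^2(L^2(R^2)).  Since |I| = 2^-i and |J| = 2^-j,
      <g_J>_I <u_I>_J = 2^(i+j) int_(I x J) g_J(x) u_I(y) d(x,y).
    Put a_i(x,y) = 2^(i/2) u_(I_i(x))(y) and b_j(x,y) = 2^(j/2) g_(J_j(y))(x).
    For fixed scales i and j the rectangles I x J tile the plane, and on I x J
    the product M^ij a_i b_j equals 2^(i+j) lambda_IJ g_J(x) u_I(y); summing over
    the scales gives
      X_form lambda g u = sum_j int (M_lambda a)_j b_j      ([integral_pairing]).
    The normalization makes u |-> a and g |-> b isometric: by Tonelli the slab
    I x R contributes 2^i |I| ||u_I||^2 = ||u_I||^2 to ||a_i||^2
    ([sum_integral_sqr_dyadic_lift]), and b is the same construction with x and y
    exchanged ([integral_swap]).  Hence ||a|| = ||b|| = 1, and the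
    Cauchy-Schwarz inequality ([Cauchy_Schwarz_l2L2]) bounds the form by
    ||M_lambda a|| ||b|| <= C for each C admissible in [M_norm].

    Finite supports turn all sums over dyadic intervals into sums over
    duplicate-free sequences.  The mechanism that trades a sum over scales,
    evaluated at the dyadic interval containing a point, for a sum of indicators
    over intervals is [sum_dyadic_scales]. *)

(** * Measurability and L^2 norms *)

(** Discontinuous functions such as [M_coef] are measurable because they factor
    through a countable type, however wild the second factor is. *)
Lemma measurable_fun_factor_countable d d' (T : measurableType d)
    (U : measurableType d') (K : countType) (f : T -> K) (phi : K -> U) :
  (forall k, measurable (f @^-1` [set k])) ->
  measurable_fun setT (fun x => phi (f x)).
Proof.
move=> mf _ B _; rewrite setTI.
have -> : (fun x => phi (f x)) @^-1` B =
    \bigcup_k (if `[< B (phi k) >] then f @^-1` [set k] else set0).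
  apply/seteqP; split=> [x /= Bx|x [k _]].
    by exists (f x) => //; case: asboolP.
  by case: asboolP => // Bk fxk; rewrite /preimage /= (fxk : f x = k).
apply: countable_bigcupT_measurable; first exact: countableP.
by move=> k; case: asboolP.
Qed.

Lemma Lnorm2_sqr d (T : measurableType d) (R : realType)
    (mu : {measure set T -> \bar R}) (f : T -> R) :
  ('N[mu]_2%:E [EFin \o f] ^+ 2 = \int[mu]_x (f x ^+ 2)%:E)%E.
Proof.
have sqrE (x : \bar R) : (0 <= x -> x ^+ 2 = x `^ 2)%E.
  case: x => [x x0||]//=; last by rewrite pnatr_eq0.
  by rewrite powR_mulrn.
rewrite sqrE ?Lnorm_ge0// poweR_Lnorm//.
apply: eq_integral => x _ /=; rewrite powR_mulrn// real_normK//.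
exact: num_real.
Qed.

Lemma l2L2_sqnorm_fin d (T : measurableType d) (R : realType)
    (mu : {measure set T -> \bar R}) (S : choiceType) (f : S -> T -> R)
    (r : seq S) : uniq r -> (forall s, s \notin r -> f s = cst 0) ->
  (l2L2_sqnorm mu f = \sum_(s <- r) \int[mu]_x (f s x ^+ 2)%:E)%E.
Proof.
move=> ur f0; rewrite fsbig_seq// -esum_fset//; last first.
  by move=> s _; apply: integral_ge0 => x _; rewrite lee_fin sqr_ge0.
rewrite /l2L2_sqnorm [RHS]esum_mkcond; apply: eq_esum => s _.
rewrite Lnorm2_sqr; case: ifPn => //; rewrite notin_setE /= => /negP sr.
by apply: integral0_eq => x _; rewrite f0//= expr0n.
Qed.

Lemma l2L2_sqnorm_ge d (T : measurableType d) (R : realType)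
    (mu : {measure set T -> \bar R}) (S : choiceType) (f : S -> T -> R)
    (r : seq S) : uniq r ->
  (\sum_(s <- r) \int[mu]_x (f s x ^+ 2)%:E <= l2L2_sqnorm mu f)%E.
Proof.
move=> ur; apply: esum_ge; exists [set` r]; first by split.
by rewrite -fsbig_seq//; apply: lee_sum => s _; rewrite Lnorm2_sqr.
Qed.

(** Young's inequality |ab| <= a^2 / (2C) + C b^2 / 2, integrated and summed,
    gives C / 2 + C / 2 at once.  Once the absolute value is moved under the
    integral, only nonnegative functions are integrated, so no finiteness has to
    be checked; the price is C > 0. *)
Lemma Cauchy_Schwarz_l2L2 d (T : measurableType d) (R : realType)
    (mu : {measure set T -> \bar R}) (S : Type) (r : seq S)
    (A B : S -> T -> R) (C : R) :
  0 < C -> (forall s, measurable_fun setT (A s)) ->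
  (forall s, measurable_fun setT (B s)) ->
  (\sum_(s <- r) \int[mu]_x (A s x ^+ 2)%:E <= (C ^+ 2)%:E)%E ->
  (\sum_(s <- r) \int[mu]_x (B s x ^+ 2)%:E <= 1)%E ->
  (`|\int[mu]_x (\sum_(s <- r) A s x * B s x)%:E| <= C%:E)%E.
Proof.
move=> C0 mA mB hA hB.
have mE (D : S -> T -> R) : (forall s, measurable_fun setT (D s)) ->
    forall c s, measurable_fun setT (EFin \o (fun x => c * D s x ^+ 2)).
  move=> mD c s; apply/measurable_EFinP.
  by apply: measurable_funM => //; exact: measurable_funX.
have Z (D : S -> T -> R) (c : R) : 0 <= c ->
    (forall s, measurable_fun setT (D s)) ->
    (\int[mu]_x (\sum_(s <- r) (c * D s x ^+ 2)%:E) =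
     c%:E * \sum_(s <- r) \int[mu]_x (D s x ^+ 2)%:E)%E.
  move=> c0 mD; rewrite ge0_integral_sum//; last first.
  - by move=> s x _; rewrite lee_fin mulr_ge0// sqr_ge0.
  - by move=> s; exact: mE.
  rewrite ge0_sume_distrr; last first.
    by move=> s _; apply: integral_ge0 => x _; rewrite lee_fin sqr_ge0.
  apply: eq_bigr => s _; under eq_integral do rewrite EFinM.
  rewrite ge0_integralZl_EFin//; last first.
  - by apply/measurable_EFinP; exact: measurable_funX.
  - by move=> x _; rewrite lee_fin sqr_ge0.
apply: le_trans (le_abse_integral _ _ _) _ => //.
  apply/measurable_EFinP; apply: measurable_sum => s.
  exact: measurable_funM.
have C20 : 0 <= C / 2 by rewrite divr_ge0// ltW.
have C2V0 : 0 <= (2 * C)^-1 by rewrite invr_ge0 mulr_ge0// ltW.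
apply: (@le_trans _ _
  (\int[mu]_x (\sum_(s <- r) ((2 * C)^-1 * A s x ^+ 2)%:E +
               \sum_(s <- r) (C / 2 * B s x ^+ 2)%:E))%E).
  apply: ge0_le_integral => //.
  - apply: measurableT_comp => //; apply/measurable_EFinP.
    by apply: measurable_sum => s; exact: measurable_funM.
  - by apply: emeasurable_funD; apply: emeasurable_sum => s; exact: mE.
  - move=> x _; rewrite !sumEFin -EFinD lee_fin -big_split/=.
    apply: le_trans (ler_norm_sum _ _ _) _; apply: ler_sum => s _.
    set a := A s x; set b := B s x; rewrite ler_norml.
    (* The two signs of the absolute value are e = 1 and e = -1; in both cases
       the difference of the two sides is 1 / (2C) times a square. *)
    have h (e : R) : e ^+ 2 = 1 ->
        e * (a * b) <= (2 * C)^-1 * a ^+ 2 + C / 2 * b ^+ 2.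
      move=> e1; rewrite -subr_ge0.
      have -> : (2 * C)^-1 * a ^+ 2 + C / 2 * b ^+ 2 - e * (a * b) =
          (2 * C)^-1 * (a - e * C * b) ^+ 2.
        rewrite sqrrB exprMn exprMn e1; field; exact: lt0r_neq0.
      by rewrite mulr_ge0// sqr_ge0.
    have := h (-1); have := h 1; rewrite sqrrN expr1n.
    move=> /(_ erefl) h1 /(_ erefl) h2.
    by move: h1 h2; lra.
rewrite ge0_integralD//; last 4 first.
- by move=> x _; apply: sume_ge0 => s _; rewrite lee_fin mulr_ge0// sqr_ge0.
- by apply: emeasurable_sum => s; exact: mE.
- by move=> x _; apply: sume_ge0 => s _; rewrite lee_fin mulr_ge0// sqr_ge0.
- by apply: emeasurable_sum => s; exact: mE.
rewrite !Z//.
apply: (@le_trans _ _ ((2 * C)^-1%:E * (C ^+ 2)%:E + (C / 2)%:E * 1)%E).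
  by apply: leeD; apply: lee_wpmul2l.
rewrite mule1 -EFinM -EFinD lee_fin le_eqVlt; apply/orP; left; apply/eqP.
field; exact: lt0r_neq0.
Qed.

Lemma Lfun_measurable d (T : measurableType d) (R : realType)
    (mu : {measure set T -> \bar R}) (p : \bar R) (f : T -> R) :
  f \in Lfun mu p -> measurable_fun setT f.
Proof. by rewrite inE => /andP[]; rewrite inE. Qed.

Lemma Lfun2_sqr_lty d (T : measurableType d) (R : realType)
    (mu : {measure set T -> \bar R}) (f : T -> R) :
  measurable_fun setT f -> (\int[mu]_x (f x ^+ 2)%:E < +oo)%E ->
  f \in Lfun mu 2%:E.
Proof.
move=> mf; rewrite -Lnorm2_sqr => f2; rewrite inE; apply/andP; split.
  by rewrite inE.
rewrite inE /= /finite_norm; move: f2.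
by case: (Lnorm mu 2%:E (EFin \o f)) => [r _||_]; rewrite ?ltry ?ltNyr.
Qed.

Lemma finL2_support d (T : measurableType d) (R : realType)
    (mu : {measure set T -> \bar R}) (S : choiceType) (f : S -> T -> R) :
  finL2_family mu f ->
  exists2 r : seq S, uniq r & forall s, s \notin r -> f s = cst 0.
Proof.
move=> [_ /finite_seqP[r fr]]; exists (undup r); first exact: undup_uniq.
move=> s; rewrite mem_undup => sr; apply: contrapT => fs.
have : [set s | f s <> cst 0] s by [].
by rewrite fr /= (negbTE sr).
Qed.

(** * Products of functions of separate variables *)

Section tensor.
Context d1 d2 (T1 : measurableType d1) (T2 : measurableType d2) (R : realType).
Variables (m1 : {sigma_finite_measure set T1 -> \bar R})
          (m2 : {sigma_finite_measure set T2 -> \bar R}).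

Lemma measurable_tensor (f : T1 -> R) (h : T2 -> R) :
  measurable_fun setT f -> measurable_fun setT h ->
  measurable_fun setT (fun p : T1 * T2 => f p.1 * h p.2).
Proof.
by move=> mf mh; apply: measurable_funM; apply: measurableT_comp.
Qed.

Lemma ge0_integral_tensor (f : T1 -> R) (h : T2 -> R) :
  measurable_fun setT f -> measurable_fun setT h ->
  (forall x, 0 <= f x) -> (forall y, 0 <= h y) ->
  (\int[m1 \x m2]_p (f p.1 * h p.2)%:E =
   \int[m1]_x (f x)%:E * \int[m2]_y (h y)%:E)%E.
Proof.
move=> mf mh f0 h0; rewrite fubini_tonelli1; last first.
- by move=> p; rewrite lee_fin mulr_ge0.
- by apply/measurable_EFinP; exact: measurable_tensor.
rewrite -ge0_integralZr//; last 3 first.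
- exact/measurable_EFinP.
- by move=> x _; rewrite lee_fin.
- by apply: integral_ge0 => y _; rewrite lee_fin.
apply: eq_integral => x _; rewrite /fubini_F /=.
under eq_integral do rewrite EFinM.
rewrite ge0_integralZl_EFin//; first by move=> y _; rewrite lee_fin.
exact/measurable_EFinP.
Qed.

Lemma integrable_tensor (f : T1 -> R) (h : T2 -> R) :
  m1.-integrable setT (EFin \o f) -> m2.-integrable setT (EFin \o h) ->
  (m1 \x m2)%E.-integrable setT (fun p => (f p.1 * h p.2)%:E).
Proof.
move=> /integrableP[/measurable_EFinP mf fi].
move=> /integrableP[/measurable_EFinP mh hi].
apply/integrableP; split.
  by apply/measurable_EFinP; exact: measurable_tensor.
under eq_integral do rewrite abse_EFin normrM.
rewrite (@ge0_integral_tensor (fun x => `|f x|) (fun y => `|h y|))//.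
- by rewrite lte_mul_pinfty// ?ge0_fin_numE// integral_ge0.
- exact: measurableT_comp.
- exact: measurableT_comp.
Qed.

Lemma integral_tensor (f : T1 -> R) (h : T2 -> R) :
  m1.-integrable setT (EFin \o f) -> m2.-integrable setT (EFin \o h) ->
  (\int[m1 \x m2]_p (f p.1 * h p.2)%:E =
   \int[m1]_x (f x)%:E * \int[m2]_y (h y)%:E)%E.
Proof.
move=> fi hi; rewrite -integral12_prod_meas1; last exact: integrable_tensor.
rewrite /fubini_F /=.
under eq_integral => x _.
  under eq_integral do rewrite EFinM.
  rewrite integralZl//; over.
rewrite /= -(fineK (integrable_fin_num measurableT hi)).
by rewrite integralZr.
Qed.

End tensor.

Lemma integral_swap d (T : measurableType d) (R : realType)
    (m : {sigma_finite_measure set T -> \bar R}) (f : T * T -> \bar R) :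
  measurable_fun setT f -> (forall p, 0 <= f p)%E ->
  (\int[m \x m]_p f (p.2, p.1) = \int[m \x m]_p f p)%E.
Proof.
move=> mf f0; rewrite fubini_tonelli2//.
  by rewrite [RHS]fubini_tonelli1.
by apply: measurableT_comp => //; exact: measurable_swap.
Qed.

Lemma sum_pred1_seq (V : nmodType) (T : eqType) (r : seq T) (s : T)
    (G : T -> V) :
  uniq r -> s \in r -> \sum_(t <- r | t == s) G t = G s.
Proof. by move=> ur sr; rewrite -big_filter filter_pred1_uniq// big_seq1. Qed.

(** * Dyadic intervals, means and lifts to the plane *)

Section dyadic_lift.
Variable R : realType.
Implicit Types (I J : dyadic) (F : seq dyadic) (w : dyadic -> R -> R) (x : R).
Local Notation mu := (@lebesgue_measure R).

Lemma exp2_gt0 (i : int) : 0 < (2 : R) ^ i.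
Proof. exact: exprz_gt0. Qed.

Lemma measurable_dyadic_itv I : measurable (@dyadic_itv R I).
Proof. exact: measurable_itv. Qed.

Lemma lebesgue_dyadic_itv I : mu (dyadic_itv I) = (2 ^ (- I.1))%:E.
Proof.
rewrite /dyadic_itv lebesgue_measure_itv /= lte_fin ltr_pM2r ?exp2_gt0//.
rewrite ltr_int ltrDl ltr01 -EFinD rmorphD /= mulrDl mul1r.
by rewrite (addrC (_ * _)) addrK.
Qed.

Lemma indic_dyadic_itv I x :
  \1_(dyadic_itv I) x = (dyadic_at I.1 x == I)%:R :> R.
Proof.
rewrite indicE; congr (_%:R); congr nat_of_bool; apply/idP/eqP.
  by case: I => i k; rewrite inE => /dyadic_atP.
by case: I => i k /= h; rewrite inE; apply/dyadic_atP.
Qed.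

(** The dyadic intervals of one scale partition the line, so only the interval at
    [x] contributes; if it is missing from [F], both sides vanish. *)
Lemma sum_indic_dyadic_at F (v : dyadic -> R) (i : int) x :
  uniq F -> (forall I, I \notin F -> v I = 0) ->
  v (dyadic_at i x) = \sum_(I <- F | I.1 == i) \1_(dyadic_itv I) x * v I.
Proof.
move=> uF v0.
have E I : (if I.1 == i then \1_(dyadic_itv I) x * v I else 0) =
    if I == dyadic_at i x then v I else 0.
  rewrite indic_dyadic_itv; have [<-|ne] := eqVneq I.1 i.
    by rewrite eq_sym; case: eqP; rewrite ?mul1r ?mul0r.
  by case: eqP => // Ie; rewrite Ie eqxx in ne.
rewrite big_mkcond; under eq_bigr do rewrite E.
rewrite -big_mkcond /=; have [aF|/v0 va] := boolP (dyadic_at i x \in F).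
  by rewrite sum_pred1_seq.
by rewrite va big1// => I /eqP ->.
Qed.

(** Each interval of [F] is counted at its own scale and at no other; [undup]
    keeps a scale shared by several intervals from being counted repeatedly. *)
Lemma sum_dyadic_scales F (v : dyadic -> R) x :
  uniq F -> (forall I, I \notin F -> v I = 0) ->
  \sum_(i <- undup (map fst F)) v (dyadic_at i x) =
  \sum_(I <- F) \1_(dyadic_itv I) x * v I.
Proof.
move=> uF v0; under eq_bigr do rewrite (sum_indic_dyadic_at _ _ uF v0).
rewrite (exchange_big_dep xpredT)//= big_seq [RHS]big_seq.
apply: eq_bigr => I IF; under eq_bigl do rewrite eq_sym.
by rewrite sum_pred1_seq ?undup_uniq// mem_undup map_f.
Qed.

Lemma meanE (f : R -> R) I :
  mean f I = 2 ^ I.1 * \int[mu]_x (\1_(dyadic_itv I) x * f x).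
Proof.
rewrite /mean lebesgue_dyadic_itv /= -invr_expz invrK; congr (_ * _).
rewrite Rintegral_mkcond; apply: eq_Rintegral => x _ /=.
by rewrite patch_indic mulrC.
Qed.

(** Domination: |f| <= 1 + f^2 on an interval of finite measure. *)
Lemma integrable_indicM_Lfun2 (f : R -> R) I : f \in Lfun mu 2%:E ->
  mu.-integrable setT (fun x => (\1_(dyadic_itv I) x * f x)%:E).
Proof.
move=> f2; have mf : measurable_fun setT f.
  by move: f2; rewrite inE => /andP[]; rewrite inE.
have m1 : measurable_fun setT (\1_(dyadic_itv I) : R -> R).
  by apply: measurable_indic; exact: measurable_dyadic_itv.
apply: (@le_integrable _ _ _ mu _ measurableT _
  (fun x => (\1_(dyadic_itv I) x)%:E + (f x ^+ 2)%:E)%E).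
- by apply/measurable_EFinP; exact: measurable_funM.
- move=> x _; rewrite -EFinD !abse_EFin lee_fin indicE.
  case: (x \in _); last by rewrite mul0r normr0.
  rewrite mul1r [leRHS]ger0_norm ?addr_ge0 ?sqr_ge0//.
  rewrite mulr1n -real_normK ?num_real//.
  by have := sqr_ge0 (`|f x| - 1); have := sqr_ge0 `|f x|; nra.
- apply: integrableD => //; first exact: integrable_indic_itv.
  exact: Lfun2_integrable_sqr.
Qed.

(** For [w] = u these are the functions a_i described at the top; for [w] = g they
    are the b_j with their two variables exchanged. *)
Definition dyadic_lift (w : dyadic -> R -> R) (i : int) (p : R * R) : R :=
  2 `^ (i%:~R / 2) * w (dyadic_at i p.1) p.2.

Lemma sqr_dyadic_lift w i p :
  dyadic_lift w i p ^+ 2 = 2 ^ i * w (dyadic_at i p.1) p.2 ^+ 2.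
Proof.
rewrite /dyadic_lift exprMn; congr (_ * _).
by rewrite -powR_mulrn ?powR_ge0// -powRrM divfK// powR_intmul.
Qed.

(** Finiteness of the support makes the lift a finite sum of tensor
    products. *)
Lemma measurable_dyadic_lift F w i : uniq F ->
  (forall I, I \notin F -> w I = cst 0) ->
  (forall I, measurable_fun setT (w I)) ->
  measurable_fun setT (dyadic_lift w i).
Proof.
move=> uF w0 mw.
have -> : dyadic_lift w i = fun p => 2 `^ (i%:~R / 2) *
    \sum_(I <- [seq I <- F | I.1 == i]) \1_(dyadic_itv I) p.1 * w I p.2.
  apply/funext => p; rewrite /dyadic_lift big_filter.
  rewrite (@sum_indic_dyadic_at F (fun I => w I p.2))// => I /w0 ->.
  by [].
apply: measurable_funM => //; apply: measurable_sum => I.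
apply: measurable_tensor => //.
by apply: measurable_indic; exact: measurable_dyadic_itv.
Qed.

(** The lift is an isometry: the factor 2^i in its square cancels the length of I
    in the integral over the slab I x R. *)
Lemma sum_integral_sqr_dyadic_lift F w : uniq F ->
  (forall I, I \notin F -> w I = cst 0) ->
  (forall I, measurable_fun setT (w I)) ->
  (\sum_(i <- undup (map fst F))
     \int[plane_measure R]_p (dyadic_lift w i p ^+ 2)%:E =
   \sum_(I <- F) \int[mu]_y (w I y ^+ 2)%:E)%E.
Proof.
move=> uF w0 mw; rewrite -ge0_integral_sum//; first last.
- by move=> i p _; rewrite lee_fin sqr_ge0.
- move=> i; apply/measurable_EFinP/measurable_funX.
  exact: measurable_dyadic_lift w0 mw.
have mI I : measurable_fun setT (\1_(dyadic_itv I) : R -> R).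
  by apply: measurable_indic; exact: measurable_dyadic_itv.
have mw2 I : measurable_fun setT (fun y => 2 ^ I.1 * w I y ^+ 2).
  by apply: measurable_funM => //; exact: measurable_funX.
have w20 I y : 0 <= 2 ^ I.1 * w I y ^+ 2.
  by rewrite mulr_ge0 ?sqr_ge0// ltW// exp2_gt0.
transitivity (\int[plane_measure R]_p (\sum_(I <- F)
    (\1_(dyadic_itv I) p.1 * (2 ^ I.1 * w I p.2 ^+ 2))%:E))%E.
  apply: eq_integral => p _; rewrite !sumEFin; congr (_%:E).
  under eq_bigr do rewrite sqr_dyadic_lift.
  rewrite (@sum_dyadic_scales F (fun I => 2 ^ I.1 * w I p.2 ^+ 2))//.
  by move=> I /w0 ->; rewrite expr0n mulr0.
rewrite ge0_integral_sum//; first last.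
- by move=> I p _; rewrite lee_fin mulr_ge0// indicE.
- move=> I; apply/measurable_EFinP.
  exact: (measurable_tensor (mI I) (mw2 I)).
apply: eq_bigr => I _.
rewrite [LHS](ge0_integral_tensor mu mu (mI I) (mw2 I))//.
rewrite integral_indic//; last exact: measurable_dyadic_itv.
rewrite setIT [X in (X * _)%E](lebesgue_dyadic_itv I).
under [X in (_ * X)%E]eq_integral do rewrite EFinM.
rewrite ge0_integralZl_EFin//; first last.
- by rewrite ltW// exp2_gt0.
- by apply/measurable_EFinP; exact: (measurable_funX 2 (mw I)).
- by move=> y _; rewrite lee_fin sqr_ge0.
rewrite muleA -EFinM -expfzDr ?pnatr_eq0// addNr expr0z.
by rewrite mul1e.
Qed.

(** The coefficient depends on the point only through the two integers that index
    the dyadic intervals of lengths 2^-i and 2^-j containing its coordinates. *)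
Lemma measurable_M_coef (lambda : dyadic -> dyadic -> R) i j :
  measurable_fun setT (M_coef lambda i j).
Proof.
apply: (@measurable_fun_factor_countable _ _ _ _ (int * int)%type
  (fun p : R * R => (Num.floor (p.1 * 2 ^ i), Num.floor (p.2 * 2 ^ j)))
  (fun k => 2 `^ ((i + j)%:~R / 2) * lambda (i, k.1) (j, k.2))).
move=> [k l]; set A := (X in measurable X).
have -> : A = dyadic_itv (i, k) `*` dyadic_itv (j, l).
  apply/seteqP; split=> [[x y]|[x y]] /=.
    by case=> xk yl; split; apply/dyadic_atP; rewrite /dyadic_at ?xk ?yl.
  by case=> /dyadic_atP[xk] /dyadic_atP[yl]; rewrite /A /= xk yl.
by apply: measurableX; exact: measurable_dyadic_itv.
Qed.

End dyadic_lift.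

(** * The X-form as a pairing *)

Section pairing.
Variables (R : realType) (lambda : dyadic -> dyadic -> R).
Local Notation mu := (@lebesgue_measure R).

Variables (g u : dyadic -> R -> R) (FG FU : seq dyadic).
Hypotheses (uFG : uniq FG) (g0 : forall J, J \notin FG -> g J = cst 0).
Hypotheses (uFU : uniq FU) (u0 : forall I, I \notin FU -> u I = cst 0).

Lemma dyadic_lift_eq0 (w : dyadic -> R -> R) (F : seq dyadic) (i : int) :
  (forall I, I \notin F -> w I = cst 0) -> i \notin undup (map fst F) ->
  dyadic_lift w i = cst 0.
Proof.
move=> w0; rewrite mem_undup => iF; apply/funext => p.
rewrite /dyadic_lift w0 ?mulr0//.
by apply: contra iF => /(map_f fst).
Qed.

Lemma mean_cst0 I : mean (cst 0 : R -> R) I = 0.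
Proof.
by rewrite /mean Rintegral_cst ?mul0r ?mulr0//; exact: measurable_dyadic_itv.
Qed.

Lemma X_formE : X_form lambda g u =
  \sum_(p <- (allpairs pair FU FG))
    lambda p.1 p.2 * mean (g p.2) p.1 * mean (u p.1) p.2.
Proof.
rewrite /X_form (@fsbigE _ _ _ _ _ (allpairs pair FU FG))//.
- by apply: eq_bigl => p; rewrite in_setT.
- by apply: allpairs_uniq => // -[? ?] [? ?].
- move=> [I J] _ /=; have [IU|/u0->] := boolP (I \in FU); last first.
    by rewrite mean_cst0 mulr0.
  have [JG|/g0->] := boolP (J \in FG); last first.
    by rewrite mean_cst0 mulr0 mul0r.
  by rewrite allpairs_f.
Qed.

Lemma M_applyE j p : M_apply lambda (dyadic_lift u) j p =
  \sum_(i <- undup (map fst FU)) M_coef lambda i j p * dyadic_lift u i p.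
Proof.
rewrite /M_apply (@fsbigE _ _ _ _ _ (undup (map fst FU)))//.
- by apply: eq_bigl => i; rewrite in_setT.
- exact: undup_uniq.
- by move=> i _ iF; rewrite (dyadic_lift_eq0 u0 iF) mulr0.
Qed.

(** The three half-powers of 2 combine to the 2^(i+j) that turns an integral over
    I x J into a product of means. *)
Lemma M_coef_dyadic_lift i j (p : R * R) :
  M_coef lambda i j p * dyadic_lift u i p * dyadic_lift g j (p.2, p.1) =
  let I := dyadic_at i p.1 in let J := dyadic_at j p.2 in
  lambda I J * 2 ^ I.1 * 2 ^ J.1 * (g J p.1 * u I p.2).
Proof.
rewrite /M_coef /dyadic_lift /=.
have h (n : int) : 2 `^ (n%:~R / 2) * 2 `^ (n%:~R / 2) = 2 ^ n :> R.
  by rewrite -powRD -?splitr ?powR_intmul// pnatr_eq0 implybT.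
rewrite intrD mulrDl powRD ?pnatr_eq0 ?implybT// -!h; ring.
Qed.

(** Both sums over scales become sums over intervals: first the one over i with
    j fixed, then the one over j. *)
Lemma pairing_kernel (p : R * R) :
  \sum_(j <- undup (map fst FG))
    M_apply lambda (dyadic_lift u) j p * dyadic_lift g j (p.2, p.1) =
  \sum_(q <- (allpairs pair FU FG))
    (lambda q.1 q.2 * 2 ^ q.1.1 * 2 ^ q.2.1) *
    ((\1_(dyadic_itv q.1) p.1 * g q.2 p.1) *
     (\1_(dyadic_itv q.2) p.2 * u q.1 p.2)).
Proof.
pose Phi I J := lambda I J * 2 ^ I.1 * 2 ^ J.1 * (g J p.1 * u I p.2).
have Phi0l I J : I \notin FU -> Phi I J = 0.
  by move=> /u0 uI; rewrite /Phi uI !mulr0.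
have Phi0r I J : J \notin FG -> Phi I J = 0.
  by move=> /g0 gJ; rewrite /Phi gJ mul0r mulr0.
transitivity (\sum_(j <- undup (map fst FG))
    \sum_(I <- FU) \1_(dyadic_itv I) p.1 * Phi I (dyadic_at j p.2)).
  apply: eq_bigr => j _; rewrite M_applyE mulr_suml.
  under eq_bigr do rewrite M_coef_dyadic_lift.
  rewrite (@sum_dyadic_scales _ FU (fun I => Phi I (dyadic_at j p.2)))//.
  by move=> I; exact: Phi0l.
rewrite (@sum_dyadic_scales _ FG
  (fun J => \sum_(I <- FU) \1_(dyadic_itv I) p.1 * Phi I J))//; last first.
  by move=> J JG; rewrite big1// => I _; rewrite Phi0r// mulr0.
rewrite big_allpairs exchange_big /=; apply: eq_bigr => J _.
by rewrite mulr_sumr; apply: eq_bigr => I _; rewrite /Phi; ring.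
Qed.

Hypotheses (g2 : forall J, g J \in Lfun mu 2%:E)
           (u2 : forall I, u I \in Lfun mu 2%:E).

Lemma integral_pairing :
  (\int[plane_measure R]_p (\sum_(j <- undup (map fst FG))
     M_apply lambda (dyadic_lift u) j p * dyadic_lift g j (p.2, p.1))%:E =
   (X_form lambda g u)%:E)%E.
Proof.
pose f (q : dyadic * dyadic) x := \1_(dyadic_itv q.1) x * g q.2 x.
pose h (q : dyadic * dyadic) y := \1_(dyadic_itv q.2) y * u q.1 y.
have fi q : mu.-integrable setT (EFin \o f q) by exact: integrable_indicM_Lfun2.
have hi q : mu.-integrable setT (EFin \o h q) by exact: integrable_indicM_Lfun2.
pose c (q : dyadic * dyadic) := lambda q.1 q.2 * 2 ^ q.1.1 * 2 ^ q.2.1.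
under eq_integral do rewrite pairing_kernel -sumEFin.
under eq_integral do under eq_bigr do rewrite EFinM.
rewrite integral_sum//; last first.
  move=> q; apply: integrableZl => //.
  exact: (integrable_tensor (fi q) (hi q)).
rewrite X_formE -sumEFin; apply: eq_bigr => q _.
rewrite integralZl//; last exact: (integrable_tensor (fi q) (hi q)).
rewrite [X in (_ * X)%E](integral_tensor (fi q) (hi q)).
rewrite -(fineK (integrable_fin_num _ (fi q)))//.
rewrite -(fineK (integrable_fin_num _ (hi q)))// -!EFinM.
by congr (_%:E); rewrite !meanE /Rintegral; ring.
Qed.

Lemma X_form_le (C : R) : 0 < C ->
  l2L2_sqnorm mu g = 1%E -> l2L2_sqnorm mu u = 1%E ->
  (forall a : int -> R * R -> R, finL2_family (plane_measure R) a ->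
    (l2L2_norm (plane_measure R) (M_apply lambda a)
       <= C%:E * l2L2_norm (plane_measure R) a)%E) ->
  (`|X_form lambda g u|%:E <= C%:E)%E.
Proof.
move=> C0 ng nu HC.
have mg J : measurable_fun setT (g J) by exact: Lfun_measurable (g2 J).
have mu' I : measurable_fun setT (u I) by exact: Lfun_measurable (u2 I).
have mlu i : measurable_fun setT (dyadic_lift u i).
  exact: measurable_dyadic_lift u0 mu'.
have na : l2L2_sqnorm (plane_measure R) (dyadic_lift u) = 1%E.
  rewrite (l2L2_sqnorm_fin _ (undup_uniq (map fst FU))); last first.
    by move=> i; exact: dyadic_lift_eq0.
  by rewrite sum_integral_sqr_dyadic_lift// -(l2L2_sqnorm_fin _ uFU).
have fa : finL2_family (plane_measure R) (dyadic_lift u).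
  split=> [i|].
    apply: (@Lfun2_sqr_lty _ _ R (plane_measure R) _ (mlu i)).
    apply: (@le_lt_trans _ _ 1%E); last exact: ltry.
    have := @l2L2_sqnorm_ge _ _ _ (plane_measure R) _
      (dyadic_lift u) [:: i] isT.
    by rewrite big_seq1 na.
  apply: (@sub_finite_set _ _ [set` undup (map fst FU)]) => // i /= iu.
  by apply: contraPT iu => /(dyadic_lift_eq0 u0) ->; exact.
have nMa : (l2L2_sqnorm (plane_measure R) (M_apply lambda (dyadic_lift u))
    <= (C ^+ 2)%:E)%E.
  have := HC _ fa; rewrite /l2L2_norm na /= sqrtr1 mule1.
  rewrite -[X in (_ <= X%:E)%E -> _](ger0_norm (ltW C0)) -sqrtr_sqr.
  rewrite -[X in (_ <= X)%E -> _]/(sqrte (C ^+ 2)%:E).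
  by rewrite lee_sqrt// lee_fin sqr_ge0.
have mMa j : measurable_fun setT (M_apply lambda (dyadic_lift u) j).
  have -> : M_apply lambda (dyadic_lift u) j = fun p =>
      \sum_(i <- undup (map fst FU)) M_coef lambda i j p * dyadic_lift u i p.
    by apply/funext => p; exact: M_applyE.
  apply: measurable_sum => i; apply: measurable_funM => //.
  exact: measurable_M_coef.
have mb j : measurable_fun setT (fun p : R * R => dyadic_lift g j (p.2, p.1)).
  apply: (measurableT_comp (measurable_dyadic_lift j uFG g0 mg)).
  exact: measurable_swap.
rewrite -abse_EFin -integral_pairing.
apply: (@Cauchy_Schwarz_l2L2 _ _ R (plane_measure R) _
  (undup (map fst FG)) _ _ C C0 mMa mb).
- by apply: le_trans nMa; apply: l2L2_sqnorm_ge; exact: undup_uniq.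
- rewrite -ng (l2L2_sqnorm_fin _ uFG)// -sum_integral_sqr_dyadic_lift//.
  apply: lee_sum => j _; rewrite le_eqVlt; apply/orP; left; apply/eqP.
  apply: (@integral_swap _ _ _ mu (fun p => (dyadic_lift g j p ^+ 2)%:E)).
    apply/measurable_EFinP/measurable_funX.
    exact: (measurable_dyadic_lift j uFG g0 mg).
  by move=> p; rewrite lee_fin sqr_ge0.
Qed.

End pairing.

(** Admissible constants may vanish, whereas [X_form_le] wants a positive one:
    hence the passage to C + e. *)
Theorem proposition3p1 (R : realType) (lambda : dyadic -> dyadic -> R) :
  (X_norm lambda <= M_norm lambda)%E.
Proof.
apply: ge_ereal_sup => _ [g [u [fg fu ng nu ->]]].
apply: le_ereal_inf_tmp => _ [C [C0 HC] <-].
have [FG uFG g0] := finL2_support fg; have [FU uFU u0] := finL2_support fu.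
apply/lee_addgt0Pr => e e0; rewrite -EFinD.
apply: (@X_form_le _ _ _ _ FG FU) => //; first exact: fg.1.
- exact: fu.1.
- exact: ltr_wpDl.
- move=> a fa; apply: (le_trans (HC a fa)).
  by apply: lee_wpmul2r; rewrite ?sqrte_ge0// lee_fin lerDl ltW.
Qed.
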